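(* Let $\Pi=\{1243,1324,3124,4321\}$ and let $n\ge 1$. Then $$Q_n(\Pi)=\sum_\lambda f^{\overline{\lambda}}s_\lambda$$ where the sum is over all partitions $\lambda\in\mathcal{H}_{n,3}$ with $\ell(\lambda)\le 3$, and $\overline{\lambda}$ is $\lambda$ with $\lambda_1$ replaced by $\min\{\lambda_1,2\}$. In particular, for $n\ge 6$ we have $$Q_n(\Pi)=s_n+2s_{n-1,1}+2s_{n-2,2}+3s_{n-2,1,1}+5s_{n-3,2,1}+5s_{n-4,2,2}.$$
   Context: $\mathfrak{S}_n$ is the set of permutations of $[n]$ in one-line notation. A permutation $\sigma$ contains $\pi$ as a pattern if some (not necessarily consecutive) subsequence of $\sigma$ is order-isomorphic to $\pi$; otherwise it avoids $\pi$. $\mathfrak{S}_n(\Pi)$ is the set of $\sigma\in\mathfrak{S}_n$ avoiding every $\pi\in\Pi$. $\mathrm{Des}\,\sigma=\{i\mid\sigma_i>\sigma_{i+1}\}\subseteq[n-1]$. For $S\subseteq[n-1]$, $F_S=\sum x_{i_1}\cdots x_{i_n}$ over all $i_1\le\dots\le i_n$ with $i_s<i_{s+1}$ whenever $s\in S$. $Q_n(\Pi)=\sum_{\sigma\in\mathfrak{S}_n(\Pi)}F_{\mathrm{Des}\,\sigma}$. $s_\lambda$ is the Schur function (parentheses around subscript partitions omitted), $f^\mu$ is the number of standard Young tableaux of shape $\mu$, and $\ell(\lambda)$ is the number of parts of $\lambda$. $\mathcal{H}_{n,j}$ is the set of partitions $\lambda$ of $n$ whose Young diagram does not contain the box in row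 $2$ and column $j$ (i.e. with $\lambda_2<j$). *)

(* Defs.v *)
From HB Require Import structures.
From mathcomp Require Import all_boot all_order all_fingroup all_algebra.
From mathcomp Require Import finmap multiset.
From mathcomp Require Import boolp classical_sets functions cardinality fsbigop.

Set Implicit Arguments.
Unset Strict Implicit.
Unset Printing Implicit Defensive.

Import GRing.Theory.

(* One-line notation with values in {1, ..., n}. *)
Definition one_line n (sigma : 'S_n) : seq nat :=
  [seq (sigma i).+1 | i <- enum 'I_n].

Definition order_isomorphic (a b : seq nat) : bool :=
  (size a == size b) &&
  [forall i : 'I_(size a), forall j : 'I_(size a),
     (nth 0 a i < nth 0 a j) == (nth 0 b i < nth 0 b j)].

(* The subsequences of w are the words mask m w, for m a bit vector. *)
Definition contains (w p : seq nat) : bool :=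
  [exists m : (size w).-tuple bool, order_isomorphic (mask m w) p].

Definition avoids (Pi : seq (seq nat)) (w : seq nat) : bool :=
  all (fun p => ~~ contains w p) Pi.

(* Subsets of [n-1] = {1, ..., n-1} are sets of elements of 'I_n.-1, where
   i : 'I_n.-1 stands for position i.+1; nth also counts from 0. *)
Definition Des n (w : seq nat) : {set 'I_n.-1} :=
  [set i : 'I_n.-1 | nth 0 w i.+1 < nth 0 w i].

Definition is_partition (n : nat) (la : seq nat) : bool :=
  [&& sorted geq la, 0 \notin la & sumn la == n].

(* Box in row i and column j, both counted from 1. *)
Definition in_diagram (la : seq nat) (i j : nat) : bool :=
  [&& 0 < i, 0 < j & j <= nth 0 la i.-1].

Definition in_H (n j : nat) (la : seq nat) : bool :=
  is_partition n la && ~~ in_diagram la 2 j.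

Definition bar (la : seq nat) : seq nat :=
  if la is l1 :: la' then minn l1 2 :: la' else [::].

(* A tableau is the list of its rows, from the longest to the shortest. *)
Definition entry (T : seq (seq nat)) (i j : nat) : nat := nth 0 (nth [::] T i) j.

Definition is_ssyt (la : seq nat) (T : seq (seq nat)) : Prop :=
  [/\ shape T = la,
      all (sorted leq) T &
      forall i j, j < size (nth [::] T i.+1) -> entry T i j < entry T i.+1 j].

(* Each of 1, ..., |mu| occurs exactly once, so rows increase strictly. *)
Definition is_syt (mu : seq nat) (T : seq (seq nat)) : Prop :=
  is_ssyt mu T /\ perm_eq (flatten T) (iota 1 (sumn mu)).

Local Open Scope classical_set_scope.

Definition num_syt (mu : seq nat) : nat := #|` fset_set [set T | is_syt mu T]|.

Local Open Scope ring_scope.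

(* Formal power series with integer coefficients in countably many variables
   x_0, x_1, ... (the index set N replaces {1, 2, ...}; both are infinite and
   well ordered in the same way).  A monomial is encoded as the multiset of its
   variable indices and a series maps a monomial to its coefficient. *)
Notation series := (multiset nat -> int).

(* The series x_{i_1} ... x_{i_n}, for w = [:: i_1; ...; i_n]. *)
Definition monomial (w : seq nat) : series := fun m => (seq_mset w == m)%:R.

(* The two sums below are infinite, hence coefficientwise: for a fixed m, only
   finitely many summands are nonzero. *)
Definition fundamental n (S : {set 'I_n.-1}) : series := fun m =>
  \sum_(w \in [set w : n.-tuple nat | sorted leq w /\
                 forall s : 'I_n.-1, s \in S -> (nth 0 w s < nth 0 w s.+1)%N])
    monomial w m.

Definition schur (la : seq nat) : series := fun m =>
  \sum_(T \in [set T | is_ssyt la T]) monomial (flatten T) m.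

Definition Q (n : nat) (Pi : seq (seq nat)) : series :=
  \sum_(sigma : 'S_n | avoids Pi (one_line sigma))
     fundamental (Des n (one_line sigma)).

(* Main.v *)
(* Comparing coefficients of a monomial, the theorem says that for every set S
   the number of avoiders with descent set S is the sum, over the standard
   tableaux of descent set S and of shape la as in the theorem, of f^(bar la).
   A standard tableau with at most three rows is read as a lattice word over
   {0, 1, 2} (the letter at position i is the row of i), whose ascents are the
   descents of the tableau; lambda_2 <= 2 says that the letter 1 occurs at most
   twice.

   Both counts are unchanged when an ascending run of length r >= 3 of the
   descent word is shortened to r - 1.  For avoiders: if a < b < c are adjacent
   then c = b + 1, because an intermediate value before a gives 3124 and one
   after c gives 1243; conversely, inflating b to b, b + 1 after an ascent a < b
   never creates a pattern.  For lattice words: in three weakly decreasing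
   letters the last one is 0, and it may be removed or inserted freely.  This
   leaves the words all of whose runs have length at most 2.  Those of size at
   most 10 are enumerated, and at size 10 both sides are already empty, which
   settles all longer words because both families are closed under prefixes. *)
Require Import Defs.
From mathcomp Require Import all_boot all_order all_fingroup all_algebra.
From mathcomp Require Import finmap multiset.
From mathcomp Require Import boolp classical_sets functions cardinality fsbigop.
From mathcomp Require Import zify.

Set Implicit Arguments.
Unset Strict Implicit.
Unset Printing Implicit Defensive.

Import GRing.Theory.

(** * Avoidance as a condition on quadruples of positions *)

(** The disjuncts are 1243, 1324, 3124 and 4321, in this order, for entries read from left to
    right. *)
Definition forbidden (a b c d : nat) : bool :=
  [|| [&& a < b, b < d & d < c], [&& a < c, c < b & b < d],
      [&& b < c, c < a & a < d] | [&& d < c, c < b & b < a]].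

(** Quantifying over lists of positions gives a test that [vm_compute] can run in the enumeration
    below. *)
Definition avoid (w : seq nat) : bool :=
  all (fun l => all (fun k => all (fun j => all (fun i =>
    ~~ forbidden (nth 0 w i) (nth 0 w j) (nth 0 w k) (nth 0 w l))
  (iota 0 j)) (iota 0 k)) (iota 0 l)) (iota 0 (size w)).

Lemma avoidP w :
  reflect (forall i j k l, i < j -> j < k -> k < l -> l < size w ->
             ~~ forbidden (nth 0 w i) (nth 0 w j) (nth 0 w k) (nth 0 w l))
          (avoid w).
Proof.
apply: (iffP idP) => [av_w i j k l ij jk kl l_w | av_w].
  move/allP/(_ l): av_w; rewrite mem_iota => /(_ l_w).
  move=> /allP/(_ k); rewrite mem_iota => /(_ kl).
  move=> /allP/(_ j); rewrite mem_iota => /(_ jk).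
  by move=> /allP/(_ i); rewrite mem_iota => /(_ ij).
apply/allP => l; rewrite mem_iota /= => l_w.
apply/allP => k; rewrite mem_iota /= => kl.
apply/allP => j; rewrite mem_iota /= => jk.
apply/allP => i; rewrite mem_iota /= => ij.
exact: av_w.
Qed.

Lemma order_isomorphic4 x y z t p : size p = 4 ->
  order_isomorphic [:: x; y; z; t] p =
  all (fun i => all (fun j =>
    (nth 0 [:: x; y; z; t] i < nth 0 [:: x; y; z; t] j)
      == (nth 0 p i < nth 0 p j)) (iota 0 4)) (iota 0 4).
Proof.
move=> sp; rewrite /order_isomorphic sp [size _]/=; apply/idP/idP.
  case/andP=> _ /forallP H; apply/allP => i; rewrite mem_iota => hi.
  apply/allP => j; rewrite mem_iota => hj.
  by move/forallP: (H (Ordinal (hi : i < 4))) => /(_ (Ordinal (hj : j < 4))).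
move=> H; rewrite eqxx andTb; apply/forallP => i; apply/forallP => j.
move/allP/(_ (val i)): H; rewrite mem_iota => /(_ (ltn_ord i)).
by move=> /allP/(_ (val j)); rewrite mem_iota => /(_ (ltn_ord j)).
Qed.

Lemma forbiddenE x y z t :
  forbidden x y z t =
  has (order_isomorphic [:: x; y; z; t])
    [:: [:: 1; 2; 4; 3]; [:: 1; 3; 2; 4]; [:: 3; 1; 2; 4]; [:: 4; 3; 2; 1]].
Proof.
rewrite /has !order_isomorphic4 // /forbidden.
rewrite /= !ltnn /=.
(* Six comparisons determine both sides, ties included. *)
case: (ltngtP x y) => ?; case: (ltngtP x z) => ?; case: (ltngtP x t) => ?;
case: (ltngtP y z) => ?; case: (ltngtP y t) => ?; case: (ltngtP z t) => ? //=;
lia.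
Qed.

Lemma containsP (w p : seq nat) :
  reflect (exists2 t, subseq t w & order_isomorphic t p) (contains w p).
Proof.
apply: (iffP existsP) => [[m im] | [t /subseqP [m sm ->] im]].
  by exists (mask m w) => //; exact: mask_subseq.
by exists (tcast sm (in_tuple m)); rewrite val_tcast.
Qed.

Lemma subseq_iota s n : sorted ltn s -> all (ltn^~ n) s -> subseq s (iota 0 n).
Proof.
move=> ss /allP sn; suff -> : s = [seq x <- iota 0 n | x \in s].
  exact: filter_subseq.
apply: (irr_sorted_eq ltn_trans ltnn ss).
  exact: (sorted_filter ltn_trans _ (iota_ltn_sorted 0 n)).
move=> x; rewrite mem_filter mem_iota andbC /= add0n.
by case xs: (x \in s); rewrite ?andbF // andbT; exact/esym/sn.
Qed.

Lemma avoidsE w :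
  avoids [:: [:: 1; 2; 4; 3]; [:: 1; 3; 2; 4]; [:: 3; 1; 2; 4];
             [:: 4; 3; 2; 1]] w = avoid w.
Proof.
apply/allP/avoidP => [H i j k l ij jk kl l_w | H p pin].
  apply/negP; rewrite forbiddenE => /hasP [p pin im].
  move/negP: (H p pin); apply; apply/containsP; exists
    [seq nth 0 w x | x <- [:: i; j; k; l]]; last exact: im.
  (* [w] is the image of [iota 0 (size w)] under [nth 0 w], so it suffices that the positions
     increase. *)
  rewrite -{2}(mkseq_nth 0 w); apply/map_subseq/subseq_iota => /=; lia.
apply/negP => /containsP [t st im].
have sz : size t = 4.
  by case/andP: im => /eqP -> _; move: pin; rewrite !inE => /or4P [] /eqP ->.
(* Conversely, a subsequence of length 4 is read off at four increasing positions. *)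
move: st; rewrite -(mkseq_nth 0 w) => /subseqP [m _]; rewrite /mkseq -map_mask.
move: (sorted_mask ltn_trans m (iota_ltn_sorted 0 (size w))).
have: all (ltn^~ (size w)) (mask m (iota 0 (size w))).
  by apply/allP => x /mem_mask; rewrite mem_iota.
case: (mask _ _) => [|i [|j [|k [|l [|? ?]]]]] /=.
all: try by move=> _ _ def_t; rewrite def_t in sz.
move=> l_w ijkl def_t; have: ~~ forbidden (nth 0 w i) (nth 0 w j) (nth 0 w k) (nth 0 w l).
  by apply: H; lia.
by rewrite forbiddenE => /hasP []; exists p; rewrite // -def_t.
Qed.

(** * Avoiders with a given descent word *)

Definition perms n := permutations (iota 1 n).

Lemma mem_perms n w :
  (w \in perms n) = [&& size w == n, uniq w & all (fun x => 0 < x <= n) w].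
Proof.
rewrite mem_permutations; apply/idP/and3P => [pw | [/eqP sw uw /allP aw]].
  rewrite (perm_size pw) size_iota (perm_uniq pw) iota_uniq; split=> //.
  by apply/allP => x; rewrite (perm_mem pw) mem_iota; lia.
apply: uniq_perm; rewrite ?iota_uniq //.
apply: (uniq_min_size uw _ _).2; last by rewrite size_iota sw.
by move=> x /aw; rewrite mem_iota; lia.
Qed.

Lemma perms_inj n w i j : w \in perms n -> i < n -> j < n ->
  nth 0 w i = nth 0 w j -> i = j.
Proof.
rewrite mem_perms => /and3P [/eqP <- uw _] iw jw /eqP.
by rewrite nth_uniq // => /eqP.
Qed.

Lemma perms_surj n w x : w \in perms n -> 0 < x <= n ->
  exists2 i, i < n & nth 0 w i = x.
Proof.
rewrite mem_permutations => pw xn.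
have xw : x \in w by rewrite (perm_mem pw) mem_iota; lia.
exists (index x w); last exact: nth_index.
by rewrite -[X in _ < X](size_iota 1) -(perm_size pw) index_mem.
Qed.

Lemma perms_bound n w i : w \in perms n -> i < n -> 0 < nth 0 w i <= n.
Proof.
rewrite mem_perms => /and3P [/eqP sw _ /allP aw] i_n; apply: aw.
by rewrite mem_nth ?sw.
Qed.

Lemma perms_size n w : w \in perms n -> size w = n.
Proof. by rewrite mem_perms => /and3P [/eqP]. Qed.

(* Position q is counted from 0; the values >= k are shifted up to make room. *)
Definition ins q k w :=
  [seq bump k x | x <- take q w] ++ k :: [seq bump k x | x <- drop q w].

Lemma size_ins q k w : size (ins q k w) = (size w).+1.
Proof. by rewrite size_cat /= !size_map addnS -size_cat cat_take_drop. Qed.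

Lemma nth_ins q k w i : q <= size w -> i <= size w ->
  nth 0 (ins q k w) i =
  if i < q then bump k (nth 0 w i) else if i == q then k
  else bump k (nth 0 w i.-1).
Proof.
move=> qw iw; rewrite nth_cat size_map size_takel //.
case: ltnP => iq; first by rewrite (nth_map 0) ?size_takel // nth_take.
case: eqP => [-> | ne]; first by rewrite subnn.
have -> : i - q = (i.-1 - q).+1 by lia.
rewrite /= (nth_map 0) ?size_drop ?nth_drop; last by lia.
by rewrite subnKC //; lia.
Qed.

Lemma ins_perms n q k w : w \in perms n -> 0 < k <= n.+1 ->
  ins q k w \in perms n.+1.
Proof.
move=> wn kn; have sw := perms_size wn; move: wn.
rewrite !mem_perms size_ins sw eqxx => /and3P [_ uw /allP aw] /=.
have pw : perm_eq (ins q k w) (k :: map (bump k) w).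
  by rewrite /ins perm_catC /= perm_cons perm_catC -map_cat cat_take_drop.
rewrite (perm_uniq pw) (perm_all _ pw) /= (map_inj_uniq (can_inj (bumpK k))) uw.
rewrite kn andbT eqxx /=; apply/andP; split.
  by apply/mapP => -[x _]; rewrite /bump; lia.
by apply/allP => _ /mapP [x /aw xn ->]; rewrite /bump; lia.
Qed.

Lemma ins_inj n q k1 k2 w1 w2 : q <= n -> w1 \in perms n -> w2 \in perms n ->
  ins q k1 w1 = ins q k2 w2 -> k1 = k2 /\ w1 = w2.
Proof.
move=> qn /perms_size s1 /perms_size s2 eq12.
have k12 : k1 = k2.
  have := congr1 (nth 0 ^~ q) eq12.
  by rewrite !nth_ins ?s1 ?s2 // ltnn eqxx.
split=> //; rewrite -k12 in eq12.
apply: (@eq_from_nth _ 0); rewrite s1 ?s2 // => i i_n.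
apply: (can_inj (bumpK k1)); case: (ltnP i q) => iq.
  by have := congr1 (nth 0 ^~ i) eq12; rewrite !nth_ins ?s1 ?s2 ?iq //; lia.
have := congr1 (nth 0 ^~ i.+1) eq12; rewrite !nth_ins ?s1 ?s2 //.
by case: ltnP => [|_]; [lia | case: eqP => //; lia].
Qed.

(** By counting: for fixed [q] the (n+1) n! insertions are pairwise distinct permutations of n+1
    letters, hence all of them. *)
Lemma perms_ins n q v : q <= n -> v \in perms n.+1 ->
  exists k w, [/\ 0 < k <= n.+1, w \in perms n & v = ins q k w].
Proof.
move=> qn vn.
pose L := [seq ins q k w | k <- iota 1 n.+1, w <- perms n].
have uL : uniq L.
  apply: allpairs_uniq; rewrite ?iota_uniq ?permutations_uniq //.
  move=> _ _ /allpairsP [[k1 w1] [_ w1n ->]] /allpairsP [[k2 w2] [_ w2n ->]].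
  by move=> /= /(ins_inj qn w1n w2n) /= [-> ->].
suff : v \in L.
  case/allpairsP => [[k w] [kn wn ->]]; exists k, w; split=> //.
  by move: kn; rewrite mem_iota /=; lia.
rewrite (uniq_min_size uL (s2 := perms n.+1) _ _).2 //.
  move=> _ /allpairsP [[k w] [kn wn ->]]; apply: ins_perms => //.
  by move: kn; rewrite mem_iota /=; lia.
rewrite size_allpairs !size_permutations ?iota_uniq // !size_iota.
by rewrite factS.
Qed.

Definition des (w : seq nat) : seq bool :=
  mkseq (fun i => nth 0 w i.+1 < nth 0 w i) (size w).-1.

Lemma size_des w : size (des w) = (size w).-1.
Proof. exact: size_mkseq. Qed.

Lemma nth_des w i : i.+1 < size w ->
  nth false (des w) i = (nth 0 w i.+1 < nth 0 w i).
Proof. by move=> iw; rewrite nth_mkseq //; lia. Qed.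

Lemma desP w d : size w = (size d).+1 ->
  reflect (forall i, i < size d ->
             nth false d i = (nth 0 w i.+1 < nth 0 w i)) (des w == d).
Proof.
move=> sw; apply: (iffP eqP) => [<- i | H].
  by rewrite size_des sw => iw; rewrite nth_des // sw.
apply: (@eq_from_nth _ false); rewrite size_des sw // => i id.
by rewrite nth_des ?sw // H.
Qed.

Lemma ltn_bump2 h x y : (bump h x < bump h y) = (x < y).
Proof. by rewrite !ltnNge leq_bump2. Qed.

(** An occurrence in [w] survives the insertion: positions from [q] on move by one, and [bump]
    preserves the order of the values. *)
Lemma avoid_ins q k w : q <= size w -> avoid (ins q k w) -> avoid w.
Proof.
move=> qw /avoidP av_w; apply/avoidP => i j k0 l ij jk kl l_w.
have E x : x < size w -> nth 0 (ins q k w) (x + (q <= x)) = bump k (nth 0 w x).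
  move=> xw; rewrite nth_ins //; last by lia.
  case: (leqP q x) => qx; rewrite ?addn0 ?qx ?addn1 //=.
  by case: ltnP => [|_]; [lia | case: eqP => //; lia].
have := av_w (i + (q <= i)) (j + (q <= j)) (k0 + (q <= k0)) (l + (q <= l)).
rewrite size_ins !E; try lia.
by rewrite /forbidden !ltn_bump2; apply; lia.
Qed.

Definition avoiders (d : seq bool) :=
  [seq w <- perms (size d).+1 | avoid w && (des w == d)].

Lemma mem_avoiders d w :
  (w \in avoiders d) = [&& w \in perms (size d).+1, avoid w & des w == d].
Proof. by rewrite mem_filter andbC. Qed.

Lemma avoiders_uniq d : uniq (avoiders d).
Proof. by rewrite filter_uniq ?permutations_uniq. Qed.

(** * Avoiders and the shortening of an ascending run *)

(** Replaces the entry [b] at position [p.+1] by two adjacent copies with values [b] and [b.+1]. *)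
Definition inflate p w := ins p.+2 (nth 0 w p.+1).+1 w.

(** [unbump p.+1] sends both copies back to position [p.+1], so entries compare as their originals
    do, except that the first copy is below the second. *)
Lemma inflate_ltn n p w i j : w \in perms n -> p.+1 < n -> i <= n -> j <= n ->
  (nth 0 (inflate p w) i < nth 0 (inflate p w) j) =
  (nth 0 w (unbump p.+1 i) < nth 0 w (unbump p.+1 j)) || ((i == p.+1) && (j == p.+2)).
Proof.
move=> wn pn i_n j_n; have sw := perms_size wn.
set b := nth 0 w p.+1.
have E x : x <= n -> nth 0 (inflate p w) x =
    if x == p.+2 then b.+1 else bump b.+1 (nth 0 w (unbump p.+1 x)).
  move=> xn; rewrite nth_ins ?sw // /unbump -/b.
  by case: (ltngtP x p.+2) => xp //; congr (bump _ (nth 0 w _)); lia.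
have ne x : x < n -> x != p.+1 -> nth 0 w x != b.
  move=> xn; apply: contra => /eqP /(perms_inj wn xn pn) ->; exact: eqxx.
have dp2 : nth 0 w (unbump p.+1 p.+2) = b by rewrite /unbump ltnSn subn1.
have dn x : x <= n -> x != p.+2 -> x != p.+1 -> nth 0 w (unbump p.+1 x) != b.
  move=> xn x1 x2; apply: ne; rewrite /unbump; lia.
rewrite !E //; case: (i =P p.+2) => [->|i2]; case: (j =P p.+2) => [->|j2].
- by rewrite dp2 !ltnn; lia.
- rewrite dp2; case: (j =P p.+1) => [->|j1].
    by rewrite /unbump !ltnn subn0 -/b /bump; lia.
  by have := dn j j_n; rewrite /bump; lia.
- rewrite dp2; case: (i =P p.+1) => [->|i1].
    by rewrite /unbump !ltnn subn0 -/b /bump; lia.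
  by have := dn i i_n; rewrite /bump; lia.
by rewrite ltn_bump2 andbF orbF.
Qed.

(** An occurrence using at most one copy collapses to one in [w]. One using both copies has two
    neighbouring letters with consecutive increasing values, and the ascent from [p] to [p.+1] in
    [w] can stand in for them. *)
Lemma avoid_inflate n p w : w \in perms n -> p.+1 < n ->
  nth 0 w p < nth 0 w p.+1 -> avoid w -> avoid (inflate p w).
Proof.
move=> wn pn asc /avoidP aw; have sw := perms_size wn.
apply/avoidP => i j k l ij jk kl; rewrite size_ins sw => ln.
have L := @inflate_ltn _ _ _ _ _ wn pn.
have D x : x <= p.+1 -> unbump p.+1 x = x by rewrite /unbump; lia.
have U x : p.+1 < x -> unbump p.+1 x = x.-1 by rewrite /unbump; lia.
(* The copies could only be the 12 of 1243, which [p] and [p.+1] would form in [w] as well. *)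
have [[ip jp]|ij2] := pselect (i = p.+1 /\ j = p.+2).
  rewrite /forbidden !L; try lia.
  have := aw p p.+1 k.-1 l.-1.
  rewrite sw ip jp /forbidden (U k) ?(U l) ?(D p.+1) ?(U p.+2) //=; lia.
(* The copies could only be the 12 of 3124, again replaced by [p] and [p.+1]. The letter 3 cannot
   sit at [p], where the value is too small. *)
have [[jp kp]|jk2] := pselect (j = p.+1 /\ k = p.+2).
  rewrite /forbidden !L; try lia.
  case: (ltngtP i p) => ip; last 2 first.
  - lia.
  - by rewrite jp kp ip (U l) ?(D p.+1) ?(D p) ?(U p.+2) //=; lia.
  have := aw i p p.+1 l.-1.
  rewrite sw jp kp /forbidden (U l) ?(D p.+1) ?(D i) ?(U p.+2) //=; lia.
(* None of the four patterns ends in an ascent of consecutive values. *)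
have [[kp lp]|kl2] := pselect (k = p.+1 /\ l = p.+2).
  rewrite /forbidden !L; try lia.
  rewrite kp lp ?(D p.+1) ?(D i) ?(D j) ?(U p.+2) //=; lia.
(* The copies no longer occur together, so all comparisons are those of [w]. *)
have F x y : x < y -> y <= n -> (x = p.+1 /\ y = p.+2 -> False) ->
    (nth 0 (inflate p w) x < nth 0 (inflate p w) y) =
      (nth 0 w (unbump p.+1 x) < nth 0 w (unbump p.+1 y)) /\
    (nth 0 (inflate p w) y < nth 0 (inflate p w) x) =
      (nth 0 w (unbump p.+1 y) < nth 0 w (unbump p.+1 x)).
  move=> xy yn xyp; rewrite !L; lia.
have M x y : x < y -> (x = p.+1 /\ y = p.+2 -> False) ->
    unbump p.+1 x < unbump p.+1 y by rewrite /unbump; lia.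
have -> : forbidden (nth 0 (inflate p w) i) (nth 0 (inflate p w) j) (nth 0 (inflate p w) k)
      (nth 0 (inflate p w) l) = forbidden (nth 0 w (unbump p.+1 i))
      (nth 0 w (unbump p.+1 j)) (nth 0 w (unbump p.+1 k)) (nth 0 w (unbump p.+1 l)).
  rewrite /forbidden; have [|-> ->] := F i j ij _ ij2; first by lia.
  have [|-> ->] := F j k jk _ jk2; first by lia.
  have [_ ->] := F k l kl ln kl2.
  have [|||-> ->] := F i k _ _ _; [lia | lia | lia |].
  have [|||-> _] := F i l _ _ _; [lia | lia | lia |].
  by have [|||-> _] := F j l _ _ _; [lia | lia | lia |].
by apply: aw; rewrite ?sw ?M // /unbump; lia.
Qed.

(** The guard treats the index of the inserted entry, where [unbump] would read the head of [d2]
    instead. *)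
Lemma nth_insert_false d1 d2 i :
  nth false (d1 ++ [:: false, false & d2]) i =
  (i != (size d1).+1) && nth false (d1 ++ false :: d2) (unbump (size d1).+1 i).
Proof.
rewrite /unbump; case: (ltngtP i (size d1).+1) => [ip | ip | ->].
- rewrite subn0 /= !nth_cat; case: ltnP => // ip'.
  have -> : i = size d1 by lia.
  by rewrite subnn.
- rewrite subn1 /= !nth_cat.
  have -> : (i < size d1) = false by lia.
  have -> : (i.-1 < size d1) = false by lia.
  have -> : i - size d1 = (i - size d1).-2.+2 by lia.
  by rewrite (_ : i.-1 - size d1 = (i - size d1).-2.+1) //; lia.
by rewrite nth_cat ltnNge leqnSn subSnn.
Qed.

(** [inflate p] is a bijection, inverted by deleting the entry at [p.+2]. The point is that in an
    avoider this entry is one more than its left neighbour. *)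
Lemma size_avoiders_contract d1 d2 :
  size (avoiders (d1 ++ [:: false, false & d2])) = size (avoiders (d1 ++ false :: d2)).
Proof.
set p := size d1; set d := d1 ++ _; set d' := d1 ++ _.
have sd' : size d' = (p + size d2).+1 by rewrite size_cat /=; lia.
have sd : size d = (size d').+1 by rewrite !size_cat /=; lia.
have nd := nth_insert_false d1 d2; rewrite -/d -/d' -/p in nd.
have d'p : nth false d' p = false by rewrite nth_cat ltnn subnn.
have pn : p.+1 < (size d').+1 by lia.
suff/perm_size <- : perm_eq [seq inflate p w | w <- avoiders d'] (avoiders d) by rewrite size_map.
apply: uniq_perm (avoiders_uniq _) _.
  rewrite map_inj_in_uniq ?avoiders_uniq // => w1 w2.
  rewrite !mem_avoiders => /and3P [w1n _ _] /and3P [w2n _ _].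
  by move=> /(ins_inj _ w1n w2n) [] //; lia.
move=> v; rewrite mem_avoiders sd; apply/mapP/and3P.
  case=> w; rewrite mem_avoiders => /and3P [wn aw dw] ->.
  have sw := perms_size wn; move/desP: dw => /(_ sw) dw.
  have asc : nth 0 w p < nth 0 w p.+1.
    have pd : p < size d' by lia.
    have := dw p pd; rewrite d'p => /esym/negbT; rewrite -leqNgt => le.
    by rewrite ltn_neqAle le andbT; apply/eqP => /(perms_inj wn); lia.
  split; last 2 first.
  - exact: avoid_inflate wn pn asc aw.
  - apply/desP => [|i id]; first by rewrite size_ins sw sd.
    rewrite nd !(inflate_ltn wn pn) ?sd; try lia.
    have D x : x <= p.+1 -> unbump p.+1 x = x by rewrite /unbump; lia.
    have U x : p.+1 < x -> unbump p.+1 x = x.-1 by rewrite /unbump; lia.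
    case: (ltngtP i p.+1) => ip.
    + by rewrite !D ?dw //=; lia.
    + by rewrite !U ?dw //= ?prednK //; lia.
    by rewrite ip (D p.+1) // U // ltnn; lia.
  apply: ins_perms => //; have := perms_bound wn pn.
  by lia.
case=> vn avv /desP dv.
have sv := perms_size vn; rewrite sd in dv; move/(_ sv): dv => dv.
have [|k [w [kn wn def_v]]] := perms_ins (q := p.+2) _ vn; first by lia.
have sw := perms_size wn.
have asc i : i < (size d').+1 -> nth false d i = false ->
    nth 0 v i < nth 0 v i.+1.
  move=> id; rewrite dv // => /negbT; rewrite -leqNgt => le.
  rewrite ltn_neqAle le andbT; apply/eqP => /(perms_inj vn).
  by lia.
have asc1 : nth 0 v p < nth 0 v p.+1.
  by apply: asc; rewrite ?nd /unbump ?ltnNge ?leqnSn /= ?subn0 ?d'p ?andbF //; lia.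
have asc2 : nth 0 v p.+1 < nth 0 v p.+2 by apply: asc; rewrite ?nd ?eqxx //; lia.
have vE i : i < p.+2 -> nth 0 v i = bump k (nth 0 w i).
  by move=> ip; rewrite def_v nth_ins ?sw ?ip //; lia.
have vk : nth 0 v p.+2 = k.
  by rewrite def_v nth_ins ?sw ?ltnn ?eqxx //; lia.
have def_k : k = (nth 0 w p.+1).+1.
  move: (asc2); rewrite vk vE // {1}/bump => lt_k.
  apply/eqP; rewrite eqn_leq; apply/andP; split; last by lia.
  rewrite leqNgt; apply/negP => gap.
  (* [q] is the position of a value strictly between those at [p.+1] and [p.+2]. Left of [p] it
     creates 3124, right of [p.+2] it creates 1243. *)
  have [|q qn vq] := perms_surj (x := (nth 0 w p.+1).+1) vn; first by lia.
  have wp1 : nth 0 v p.+1 = nth 0 w p.+1 by rewrite vE // /bump; lia.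
  move/avoidP: avv; rewrite sv => avv.
  case: (ltngtP q p) => qp; last by rewrite qp in vq; lia.
    have := avv q p p.+1 p.+2; rewrite /forbidden vq vk; lia.
  case: (ltngtP q p.+2) => qp2; last by rewrite qp2 vk in vq; lia.
    have qp1 : q = p.+1 by lia.
    by rewrite qp1 in vq; lia.
  have := avv p p.+1 p.+2 q; rewrite /forbidden vq vk; lia.
exists w; last by rewrite def_v def_k.
rewrite mem_avoiders wn; apply/and3P; split=> //.
  by apply: (@avoid_ins p.+2 k); rewrite ?sw -?def_v //; lia.
have vI : v = inflate p w by rewrite def_v def_k.
apply/desP => // i id.
have D x : x <= p.+1 -> unbump p.+1 x = x by rewrite /unbump; lia.
have U x : p.+1 < x -> unbump p.+1 x = x.-1 by rewrite /unbump; lia.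
case: (leqP i p) => ip.
  have := dv i; rewrite nd vI !(inflate_ltn wn pn) ?(D i) ?(D i.+1); lia.
have := dv i.+1; rewrite nd vI !(inflate_ltn wn pn) ?(U i.+1) ?(U i.+2) /=; lia.
Qed.

(** * Enumeration of avoiders *)

(* Computes [avoiders d] by appending one last value at a time. *)
Definition avoiders_step (L : seq (seq nat)) (b : bool) :=
  [seq v <- [seq v <- [seq ins (size w) k w | w <- L, k <- iota 1 (size w).+1] |
               last false (des v) == b] | avoid v].

Definition avoiders_gen := foldl avoiders_step [:: [:: 1]].

Lemma des_ins_last k w : 0 < size w ->
  des (ins (size w) k w) = rcons (des w) (last false (des (ins (size w) k w))).
Proof.
move=> w0; set v := ins _ k w.
have sv : size v = (size w).+1 by exact: size_ins.
have vE i : i < size w -> nth 0 v i = bump k (nth 0 w i).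
  by move=> iw; rewrite nth_ins ?iw //; lia.
apply: (@eq_from_nth _ false); rewrite ?size_rcons !size_des sv /=; first by lia.
move=> i iw; rewrite nth_rcons size_des; case: ltnP => i1.
  by rewrite !nth_des ?sv ?vE ?ltn_bump2 //; lia.
have -> : i = (size w).-1 by lia.
by rewrite eqxx -nth_last size_des sv.
Qed.

(** Deleting the last entry and standardizing preserves avoidance and truncates the descent word, so
    each avoider is generated exactly once. *)
Lemma perm_avoiders_gen d : perm_eq (avoiders_gen d) (avoiders d).
Proof.
elim/last_ind: d => [|d b IHd]; first by [].
rewrite /avoiders_gen foldl_rcons -/(avoiders_gen d) /avoiders_step -filter_predI.
have size_gen w : w \in avoiders_gen d -> size w = (size d).+1 /\ w \in perms (size d).+1.
  rewrite (perm_mem IHd) mem_avoiders => /and3P [wn _ _].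
  by rewrite (perms_size wn).
apply: uniq_perm; last 1 first.
- move=> v; rewrite mem_filter [predI _ _ v]/= mem_avoiders size_rcons.
  apply/andP/and3P => [[/andP [av_v /eqP dv]] | [vn av_v /eqP dv]].
    case/allpairsPdep => w [k [wd kn def_v]].
    have [sw wn] := size_gen _ wd; split=> //.
      by rewrite def_v ins_perms //; move: kn; rewrite sw mem_iota; lia.
    move: wd; rewrite (perm_mem IHd) mem_avoiders => /and3P [_ _ /eqP <-].
    by rewrite -dv def_v {1}des_ins_last ?sw.
  have [k [w [kn wn def_v]]] := perms_ins (leqnn _) vn.
  have sw := perms_size wn.
  have dE := @des_ins_last k w; rewrite sw -def_v dv in dE.
  move/rcons_inj: (dE isT) => [dw bE].
  rewrite av_v dv last_rcons eqxx; split=> //.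
  apply/allpairsPdep; exists w, k; rewrite sw; split=> //; last first.
    by rewrite mem_iota; lia.
  rewrite (perm_mem IHd) mem_avoiders wn dw eqxx andbT /=.
  by apply: (@avoid_ins (size d).+1 k); rewrite ?sw -?def_v.
- apply/filter_uniq/allpairs_uniq_dep.
  + by rewrite (perm_uniq IHd) avoiders_uniq.
  + by move=> w _; exact: iota_uniq.
  move=> [w1 k1] [w2 k2] /allpairsPdep [w [k [wd _ [-> _]]]].
  move=> /allpairsPdep [w' [k' [wd' _ [-> _]]]] /=.
  have [-> wn] := size_gen _ wd; have [-> wn'] := size_gen _ wd'.
  by move=> /(ins_inj (leqnn _) wn wn') [-> ->].
exact: avoiders_uniq.
Qed.

Lemma foldl_avoiders_step_nil e : foldl avoiders_step [::] e = [::].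
Proof. by elim: e. Qed.

(** The generator for [d ++ e] continues from the list for [d], and an empty list stays empty. *)
Lemma avoiders_prefix d e : avoiders d = [::] -> avoiders (d ++ e) = [::].
Proof.
move=> d0; apply/nilP; rewrite /nilp -(perm_size (perm_avoiders_gen _)).
have -> : avoiders_gen (d ++ e) = foldl avoiders_step (avoiders_gen d) e.
  by rewrite /avoiders_gen foldl_cat.
have /nilP -> : nilp (avoiders_gen d) by rewrite /nilp (perm_size (perm_avoiders_gen d)) d0.
by rewrite foldl_avoiders_step_nil.
Qed.

Fixpoint bitseqs n :=
  if n is n'.+1 then [seq b :: d | b <- [:: true; false], d <- bitseqs n'] else [:: [::]].

(* Two adjacent entries [false] are a run of length >= 3. *)
Fixpoint short_runs (d : seq bool) :=
  if d is b :: d' then (b || head true d') && short_runs d' else true.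

(** * Lattice words with a given ascent word *)

Fixpoint words n : seq (seq nat) :=
  if n is n'.+1 then [seq rcons r x | r <- words n', x <- [:: 0; 1; 2]]
  else [:: [::]].

Lemma words_uniq n : uniq (words n).
Proof.
elim: n => // n IHn; apply: allpairs_uniq => //.
by move=> _ _ /allpairsP [[r x] [_ _ ->]] /allpairsP [[s y] [_ _ ->]] /rcons_inj.
Qed.

Lemma mem_words n (r : seq nat) : (r \in words n) = (size r == n) && all (ltn^~ 3) r.
Proof.
elim/last_ind: r n => [|r x IHr] [|n].
- by [].
- by apply/allpairsP => -[[r x] [_ _ /(congr1 size)]]; rewrite size_rcons.
- by rewrite size_rcons; case: r {IHr}.
rewrite size_rcons eqSS all_rcons andbCA -IHr.
apply/allpairsP/andP => [[[s y] [sn y3 /rcons_inj [-> ->]]] | [x3 rn]].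
  by split=> //; move: y3; rewrite /= !inE => /or3P [] /eqP ->.
exists (r, x); split=> //=.
by case: x x3 => [|[|[|]]].
Qed.

(** The ballot (Yamanouchi) condition for three letters. *)
Definition lattice (r : seq nat) :=
  all (fun t => (count_mem 1 (take t r) <= count_mem 0 (take t r)) &&
                (count_mem 2 (take t r) <= count_mem 1 (take t r)))
      (iota 0 (size r).+1).

Lemma latticeP r :
  reflect (forall t, count_mem 1 (take t r) <= count_mem 0 (take t r) /\
                     count_mem 2 (take t r) <= count_mem 1 (take t r))
          (lattice r).
Proof.
apply: (iffP allP) => [H t | H t _]; last by apply/andP.
case: (leqP t (size r)) => tr.
  by apply/andP/H; rewrite mem_iota.
have := H (size r); rewrite take_size take_oversize; last exact: ltnW.
by rewrite mem_iota add0n ltnSn => /(_ isT) /andP.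
Qed.

Lemma lattice_rcons r x : lattice (rcons r x) =
  [&& lattice r, count_mem 1 (rcons r x) <= count_mem 0 (rcons r x)
    & count_mem 2 (rcons r x) <= count_mem 1 (rcons r x)].
Proof.
have iota_last m : iota 0 m.+1 = rcons (iota 0 m) m.
  by rewrite -cats1 -addn1 iotaD.
rewrite /lattice size_rcons [in LHS]iota_last all_rcons andbC.
rewrite take_oversize ?size_rcons //; congr andb.
apply: eq_in_all => t; rewrite mem_iota add0n ltnS => /andP [_ tr].
by rewrite -cats1 takel_cat.
Qed.

Lemma count_take_S a (r : seq nat) t : t < size r ->
  count_mem a (take t.+1 r) = count_mem a (take t r) + (nth 0 r t == a).
Proof.
by move=> tr; rewrite (take_nth 0) // -cats1 count_cat /= addn0.
Qed.

Lemma count_take_mono a (r : seq nat) s t : s <= t ->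
  count_mem a (take s r) <= count_mem a (take t r).
Proof.
move=> st; rewrite -(cat_take_drop s (take t r)) count_cat take_takel //.
exact: leq_addr.
Qed.

Lemma count_take_le a (r : seq nat) t :
  count_mem a (take t r) <= count_mem a r.
Proof. by rewrite -[X in _ <= count_mem a X](cat_take_drop t r) count_cat leq_addr. Qed.

Lemma nth_letter i r : all (ltn^~ 3) r -> nth 0 r i < 3.
Proof. by move/(all_nthP 0) => r3; case: (ltnP i (size r)) => [/r3|/(nth_default 0) ->]. Qed.

(** Each 2 is matched with an earlier 1. Three positive letters in weakly decreasing order are some
    2s followed by 1s, so they would force three 1s. *)
Lemma lattice_weak_descents r i j k : all (ltn^~ 3) r -> lattice r ->
  count_mem 1 r <= 2 -> i < j -> j < k -> k < size r ->
  nth 0 r j <= nth 0 r i -> nth 0 r k <= nth 0 r j -> nth 0 r k = 0.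
Proof.
move=> r3 /latticeP lr c1 ij jk kr rji rkj.
have ri := nth_letter i r3.
have [_ L1] := lr i.+1; have [_ L2] := lr j.+1; have [_ L3] := lr k.+1.
rewrite !count_take_S in L1 L2 L3; try lia.
have := count_take_le 1 r k.+1; rewrite count_take_S //.
have := count_take_mono 1 r ij; have := count_take_mono 1 r jk.
have := count_take_mono 2 r ij; have := count_take_mono 2 r jk.
rewrite !count_take_S; lia.
Qed.

(** If the letter at [p.+1] is 0, it joins the 0 that opens the word. Otherwise both letters are
    positive and force two 1s, hence two 0s. *)
Lemma lattice_two_zeros r p : all (ltn^~ 3) r -> lattice r -> p.+1 < size r ->
  nth 0 r p.+1 <= nth 0 r p -> 2 <= count_mem 0 (take p.+2 r).
Proof.
move=> r3 /latticeP lr pr rp.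
have rp3 := nth_letter p r3.
have := lr p; have := lr p.+1; have := lr p.+2.
rewrite !count_take_S; lia.
Qed.

Definition asc (r : seq nat) : seq bool :=
  mkseq (fun i => nth 0 r i < nth 0 r i.+1) (size r).-1.

Lemma size_asc r : size (asc r) = (size r).-1.
Proof. exact: size_mkseq. Qed.

Lemma nth_asc r i : i.+1 < size r ->
  nth false (asc r) i = (nth 0 r i < nth 0 r i.+1).
Proof. by move=> ir; rewrite nth_mkseq //; lia. Qed.

Lemma ascP r d : size r = (size d).+1 ->
  reflect (forall i, i < size d ->
             nth false d i = (nth 0 r i < nth 0 r i.+1)) (asc r == d).
Proof.
move=> sr; apply: (iffP eqP) => [<- i | H].
  by rewrite size_asc sr => ir; rewrite nth_asc // sr.
apply: (@eq_from_nth _ false); rewrite size_asc sr // => i id.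
by rewrite nth_asc ?sr // H.
Qed.

Definition lattice_words (d : seq bool) :=
  [seq r <- words (size d).+1 | [&& lattice r, count_mem 1 r <= 2 & asc r == d]].

Lemma mem_lattice_words d (r : seq nat) : (r \in lattice_words d) =
  [&& (size r == (size d).+1) && all (ltn^~ 3) r,
      lattice r, count_mem 1 r <= 2 & asc r == d].
Proof. by rewrite mem_filter mem_words andbC. Qed.

Lemma lattice_words_uniq d : uniq (lattice_words d).
Proof. by rewrite filter_uniq ?words_uniq. Qed.

(** A computable form of $f^\mu$ for [mu] with at most three parts. *)
Definition num_lattice_words (mu : seq nat) :=
  size [seq u <- words (sumn mu) | lattice u &&
    [&& count_mem 0 u == nth 0 mu 0, count_mem 1 u == nth 0 mu 1
      & count_mem 2 u == nth 0 mu 2]].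

Definition content r := [:: count_mem 0 r; count_mem 1 r; count_mem 2 r].

(* The content of a lattice word without its zero entries is a partition la, and
   the weight is f^(bar la), see [num_sytE]. *)
Definition weight r := num_lattice_words (bar [seq c <- content r | c != 0]).

(** * Lattice words and the shortening of a weakly decreasing run *)

Definition ins0 p (r : seq nat) := take p r ++ 0 :: drop p r.

Lemma nth_ins0 p r i : p <= size r ->
  nth 0 (ins0 p r) i = if i == p then 0 else nth 0 r (unbump p i).
Proof.
move=> pr; rewrite nth_cat size_takel // /unbump.
case: (ltngtP i p) => ip; last by rewrite ip subnn.
  by rewrite nth_take // subn0.
have -> : i - p = (i - p.+1).+1 by lia.
by rewrite /= nth_drop; congr (nth 0 r _); lia.
Qed.

Lemma take_ins0 p r t : p <= size r ->
  take t (ins0 p r) = if t <= p then take t r else ins0 p (take t.-1 r).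
Proof.
move=> pr; rewrite take_cat size_takel //; case: ltngtP => tp.
- by rewrite take_takel // ltnW.
- rewrite /ins0 take_takel; last by lia.
  have -> : t - p = (t.-1 - p).+1 by lia.
  by rewrite /= take_drop; congr (_ ++ _ :: drop _ (take _ _)); lia.
by rewrite tp subnn take0 cats0.
Qed.

Lemma count_ins0 a p r : count a (ins0 p r) = count a (0 :: r).
Proof. by rewrite count_cat /= addnCA -count_cat cat_take_drop. Qed.

Lemma size_ins0 p r : size (ins0 p r) = (size r).+1.
Proof. by rewrite size_cat /= addnS -size_cat cat_take_drop. Qed.

Lemma all_ins0 p r : all (ltn^~ 3) (ins0 p r) = all (ltn^~ 3) r.
Proof. by rewrite !all_count count_ins0 size_ins0 /= add1n eqSS. Qed.

Lemma lattice_ins0 p r : p <= size r -> lattice r -> lattice (ins0 p r).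
Proof.
move=> pr /latticeP lr; apply/latticeP => t; rewrite take_ins0 //.
by case: ifP => _; [exact: lr | have := lr t.-1; rewrite !count_ins0 /=; lia].
Qed.

(* Every prefix that contains the deleted 0 still has at least two 0's, hence at
   least as many 0's as 1's. *)
Lemma lattice_del0 p r : p <= size r -> count_mem 1 r <= 2 ->
  2 <= count_mem 0 (take p r) -> lattice (ins0 p r) -> lattice r.
Proof.
move=> pr r1 r0 /latticeP lr; apply/latticeP => t.
case: (leqP t p) => tp; first by have := lr t; rewrite take_ins0 // tp.
have := lr t.+1; rewrite take_ins0 // ltnNge (ltnW tp) /= !count_ins0 /= => -[_ c2]; split=> //.
apply: leq_trans (count_take_mono 0 r (ltnW tp)).
exact: leq_trans (count_take_le 1 r t) (leq_trans r1 r0).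
Qed.

(** From two 0s on, [bar] cuts the first part down to 2, so a further 0 does not change the
    weight. *)
Lemma weight_ins0 p r : 2 <= count_mem 0 r -> weight (ins0 p r) = weight r.
Proof.
move=> r0; rewrite /weight /content !count_ins0 /=.
by case: (count_mem 0 r) r0 => [|[|m]].
Qed.

Lemma ins0_inj p r1 r2 : p <= size r1 -> p <= size r2 ->
  ins0 p r1 = ins0 p r2 -> r1 = r2.
Proof.
move=> p1 p2 /eqP; rewrite eqseq_cat ?size_takel // eqseq_cons /=.
by case/andP => /eqP t12 /eqP d12; rewrite -(cat_take_drop p r1) t12 d12 cat_take_drop.
Qed.

(** Inserting a 0 at [p.+2] is a weight-preserving bijection. *)
Lemma sum_lattice_words_contract d1 d2 :
  \sum_(r <- lattice_words (d1 ++ [:: false, false & d2])) weight r =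
  \sum_(r <- lattice_words (d1 ++ false :: d2)) weight r.
Proof.
set p := size d1; set d := d1 ++ _; set d' := d1 ++ _.
have sd' : size d' = (p + size d2).+1 by rewrite size_cat /=; lia.
have sd : size d = (size d').+1 by rewrite !size_cat /=; lia.
have nd := nth_insert_false d1 d2; rewrite -/d -/d' -/p in nd.
have d'p : nth false d' p = false by rewrite nth_cat ltnn subnn.
have D x : x <= p.+1 -> unbump p.+1 x = x by rewrite /unbump; lia.
have U x : p.+1 < x -> unbump p.+1 x = x.-1 by rewrite /unbump; lia.
have D2 x : x <= p.+2 -> unbump p.+2 x = x by rewrite /unbump; lia.
have U2 x : p.+2 < x -> unbump p.+2 x = x.-1 by rewrite /unbump; lia.
(* The weak descent at [p] supplies the two 0s that make the weight insensitive to the insertion. *)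
have two0 (r : seq nat) : r \in lattice_words d' -> 2 <= count_mem 0 (take p.+2 r).
  rewrite mem_lattice_words => /and4P [/andP [/eqP sr r3] lr r1 /ascP dr].
  move/(_ sr): dr => dr.
  apply: lattice_two_zeros => //; first by lia.
  by rewrite leqNgt -dr ?d'p //; lia.
have -> : \sum_(r <- lattice_words d') weight r =
    \sum_(r <- [seq ins0 p.+2 r | r <- lattice_words d']) weight r.
  rewrite big_map; apply: eq_big_seq => r /two0 r0; rewrite weight_ins0 //.
  exact: leq_trans r0 (count_take_le _ _ _).
apply: perm_big; apply: uniq_perm (lattice_words_uniq _) _ _.
  rewrite map_inj_in_uniq ?lattice_words_uniq // => r1 r2.
  rewrite !mem_lattice_words => /andP [/andP [/eqP s1 _] _] /andP [/andP [/eqP s2 _] _].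
  by apply: ins0_inj; rewrite ?s1 ?s2 sd' !ltnS leq_addr.
move=> v; move: v => /= v; rewrite mem_lattice_words sd; apply/and4P/mapP; last first.
  case=> r; move: r => /= r rd ->; move: (rd) (two0 r rd).
  rewrite mem_lattice_words => /and4P [/andP [/eqP sr r3] lr r1 dr] r0.
  have pr : p.+2 <= size r by lia.
  split; first by rewrite size_ins0 sr eqxx all_ins0.
  - exact: lattice_ins0.
  - by rewrite count_ins0.
  move/ascP: dr => /(_ sr) dr.
  apply/ascP => [|i id]; first by rewrite size_ins0 sr sd.
  rewrite nd !nth_ins0 //.
  case: (ltngtP i p.+1) => ip; last 1 first.
  - by rewrite ip eqxx.
  - rewrite (D i) ?(D2 i) ?(D2 i.+1) ?dr; try lia.
    by rewrite !ifF //; lia.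
  rewrite (U i) // eqSS (gtn_eqF ip) (U2 i.+1) //=.
  case: (i =P p.+2) => [ip2|ip2]; last first.
    by rewrite (U2 i) ?dr ?prednK //; lia.
  rewrite ip2 /= dr; last by lia.
  (* The letter following the inserted 0 is now compared with 0 instead of [nth 0 r p.+1]. The
     outcome is the same: after a weak descent at [p], a second one would end in 0. *)
  have := @lattice_weak_descents r p p.+1 p.+2 r3 lr r1.
  have := dr p; rewrite d'p; lia.
case=> /andP [/eqP sv v3] lv v1 /ascP dv; rewrite sd in dv; move/(_ sv): dv => dv.
(* The third letter of the run is the 0 to be deleted. *)
have v0 : nth 0 v p.+2 = 0.
  apply: (@lattice_weak_descents v p p.+1) => //; first by lia.
    by rewrite leqNgt -dv ?nd ?D ?d'p ?andbF //; lia.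
  by rewrite leqNgt -dv ?nd ?eqxx //; lia.
pose r := take p.+2 v ++ drop p.+3 v.
have pr : p.+2 <= size r by rewrite size_cat size_takel; lia.
have def_v : v = ins0 p.+2 r.
  rewrite /ins0 /r take_size_cat ?drop_size_cat ?size_takel; try lia.
  by rewrite -v0 -drop_nth ?cat_take_drop //; lia.
have sr : size r = (size d').+1 by move: sv; rewrite def_v size_ins0; lia.
have r1 : count_mem 1 r <= 2 by move: v1; rewrite def_v count_ins0.
have r3 : all (ltn^~ 3) r by rewrite -(all_ins0 p.+2) -def_v.
have lr : lattice r.
  apply: (@lattice_del0 p.+2) => //; last by rewrite -def_v.
  have -> : take p.+2 r = take p.+2 v by rewrite {1}def_v take_ins0 // leqnn.
  apply: lattice_two_zeros => //; first by lia.
  by rewrite leqNgt -dv ?nd ?D ?d'p ?andbF //; lia.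
exists r => //; rewrite mem_lattice_words sr eqxx r3 lr r1 /=; apply/ascP => // i id.
have vlo j : j < p.+2 -> nth 0 v j = nth 0 r j.
  by move=> jp; rewrite def_v nth_ins0 // (ltn_eqF jp) D2 // ltnW.
have vhi j : p.+1 < j -> nth 0 v j.+1 = nth 0 r j.
  by move=> jp; rewrite def_v nth_ins0 // gtn_eqF ?U2.
case: (ltngtP i p.+1) => ip.
- by have := dv i; rewrite nd (D i) ?vlo //; lia.
- by have := dv i.+1; rewrite nd (U i.+1) ?vhi //=; lia.
(* At the place of the deletion the same comparison argument applies. *)
have := @lattice_weak_descents r p p.+1 p.+2 r3 lr r1.
have := dv p; have := dv p.+2; rewrite !nd (D p) // (U p.+2) //= d'p v0 ip.
rewrite (vlo p) ?(vlo p.+1) ?(vhi p.+2) //; lia.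
Qed.

(** * Enumeration of lattice words and the finite comparison *)

(** Filtering at every step loses nothing because all conditions pass to prefixes, and it keeps the
    lists short. *)
Definition lattice_words_step (L : seq (seq nat)) (b : bool) :=
  [seq v <- [seq rcons r x | r <- L, x <- [:: 0; 1; 2]] |
     [&& lattice v, count_mem 1 v <= 2 & last false (asc v) == b]].

Definition lattice_words_gen := foldl lattice_words_step [:: [:: 0]].

Lemma asc_rcons r x : 0 < size r ->
  asc (rcons r x) = rcons (asc r) (last false (asc (rcons r x))).
Proof.
move=> r0; set v := rcons r x.
have sv : size v = (size r).+1 by exact: size_rcons.
have vE i : i < size r -> nth 0 v i = nth 0 r i.
  by move=> ir; rewrite nth_rcons ir.
apply: (@eq_from_nth _ false); rewrite ?size_rcons !size_asc sv /=; first by lia.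
move=> i iw; rewrite nth_rcons size_asc; case: ltnP => i1.
  by rewrite !nth_asc ?sv ?vE //; lia.
have -> : i = (size r).-1 by lia.
by rewrite eqxx -nth_last size_asc sv.
Qed.

Lemma perm_lattice_words_gen d : perm_eq (lattice_words_gen d) (lattice_words d).
Proof.
elim/last_ind: d => [|d b IHd]; first by vm_compute.
rewrite /lattice_words_gen foldl_rcons -/(lattice_words_gen d).
apply: uniq_perm; last 1 first.
- move=> /= v; rewrite mem_filter mem_lattice_words size_rcons.
  apply/andP/and4P => [[/and3P [lv v1 /eqP bE]] | [vn lv v1 /eqP dv]].
    case/allpairsP => [[r x] [rd xn def_v]].
    move: rd; rewrite (perm_mem IHd) mem_lattice_words => /and4P [/andP [/eqP sr r3] lr r1 /eqP dr].
    split=> //.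
      rewrite def_v size_rcons sr eqxx all_rcons r3 andbT.
      by move: xn; rewrite !inE => /or3P [] /eqP ->.
    by rewrite -bE -dr def_v {1}asc_rcons ?sr.
  case/lastP: v vn lv v1 dv => [|r x] // /andP [].
  rewrite size_rcons all_rcons eqSS => sr /andP [x3 r3] lv v1 dv.
  have r0 : 0 < size r by rewrite (eqP sr).
  move: (asc_rcons x r0); rewrite dv last_rcons => /rcons_inj [dE].
  rewrite lv v1 eqxx; split=> //.
  apply/allpairsP; exists (r, x); split=> //=; last first.
    by case: x x3 {lv v1 dv} => [|[|[|]]].
  rewrite (perm_mem IHd) mem_lattice_words sr r3 dE eqxx andbT /=.
  move: lv; rewrite lattice_rcons => /andP [-> _] /=.
  by rewrite andbT; move: v1; rewrite -cats1 count_cat; apply/leq_trans/leq_addr.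
- apply/filter_uniq/allpairs_uniq => //.
    by rewrite (perm_uniq IHd) lattice_words_uniq.
  by move=> _ _ /allpairsP [[r x] [_ _ ->]] /allpairsP [[s y] [_ _ ->]] /rcons_inj.
exact: lattice_words_uniq.
Qed.

Lemma foldl_lattice_words_step_nil e : foldl lattice_words_step [::] e = [::].
Proof. by elim: e. Qed.

Lemma lattice_words_prefix d e : lattice_words d = [::] -> lattice_words (d ++ e) = [::].
Proof.
move=> d0; apply/nilP; rewrite /nilp -(perm_size (perm_lattice_words_gen _)).
have -> : lattice_words_gen (d ++ e) =
    foldl lattice_words_step (lattice_words_gen d) e.
  by rewrite /lattice_words_gen foldl_cat.
have /nilP -> : nilp (lattice_words_gen d).
  by rewrite /nilp (perm_size (perm_lattice_words_gen d)) d0.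
by rewrite foldl_lattice_words_step_nil.
Qed.

Lemma mem_bitseqs n d : (d \in bitseqs n) = (size d == n).
Proof.
elim: n d => [|n IHn] [|b d] //.
  by apply/negbTE/allpairsP => -[[b d] [_ _]].
rewrite [size _]/= eqSS -IHn; apply/allpairsP/idP => [[[b' d'] [_ dn [_ ->]]] // | dn].
by exists (b, d); split=> //; case: b.
Qed.

(** The second clause serves the longer words, through their prefixes of size 10. *)
Definition counts_agree d :=
  (size (avoiders_gen d) == sumn (map weight (lattice_words_gen d))) &&
  ((size d == 10) ==> nilp (avoiders_gen d) && nilp (lattice_words_gen d)).

Lemma counts_agree_short_runs :
  all (fun n => all counts_agree [seq d <- bitseqs n | short_runs d]) (iota 0 11).
Proof. by vm_compute. Qed.

Lemma size_avoiders_short_runs d : short_runs d ->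
  size (avoiders d) = \sum_(r <- lattice_words d) weight r.
Proof.
have E (e : bitseq) : size e <= 10 -> short_runs e ->
    size (avoiders e) = \sum_(r <- lattice_words e) weight r /\
    (size e = 10 -> avoiders e = [::] /\ lattice_words e = [::]).
  move=> e10 fe; move/allP: counts_agree_short_runs => /(_ (size e)).
  rewrite mem_iota => /(_ e10) /allP /(_ e); rewrite mem_filter fe mem_bitseqs eqxx.
  move=> /(_ isT) /andP [/eqP se nil_e].
  rewrite -(perm_size (perm_avoiders_gen e)) se sumnE big_map.
  rewrite (perm_big _ (perm_lattice_words_gen e)).
  split=> // e_10; move: nil_e; rewrite e_10 /nilp.
  rewrite (perm_size (perm_avoiders_gen e)) (perm_size (perm_lattice_words_gen e)).
  by case/andP => /nilP -> /nilP ->.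
move=> fd; case: (leqP (size d) 10) => d10; first by case: (E d d10 fd).
(* Cutting the word replaces a next entry by the default [true], which only weakens the test. *)
have ft : short_runs (take 10 d).
  elim: {d10} d (10) fd => [|b d IHd] [|k] //= /andP [bd fd].
  by rewrite IHd // andbT; case: d k bd {IHd fd} => [|? ?] [|?] //=; rewrite ?orbT.
have st : size (take 10 d) = 10 by rewrite size_takel // ltnW.
have [] := E (take 10 d); rewrite ?st // => _ [] // a0 l0.
by rewrite -(cat_take_drop 10 d) avoiders_prefix // lattice_words_prefix // big_nil.
Qed.

Lemma size_avoiders d : size (avoiders d) = \sum_(r <- lattice_words d) weight r.
Proof.
elim: {d}(size d) {-2}d (leqnn (size d)) => [|n IHn] d dn.
  by apply: size_avoiders_short_runs; case: d dn.
case: (boolP (short_runs d)) => [|ffd]; first exact: size_avoiders_short_runs.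
have [d1 [d2 def_d]] : exists d1 d2, d = d1 ++ [:: false, false & d2].
  elim: d ffd {dn} => //= b d IHd; rewrite negb_and negb_or.
  case/orP => [/andP [] | /IHd [d1 [d2 ->]]]; last by exists (b :: d1), d2.
  by case: b d {IHd} => -[|[] d] // _ _; exists [::], d.
rewrite def_d size_avoiders_contract sum_lattice_words_contract; apply: IHn.
by move: dn; rewrite def_d !size_cat /= !addnS.
Qed.

(** * Reading semistandard tableaux as lattice words *)

(* A cell is a pair (entry, row).  Equal entries form a horizontal strip, which is
   read from left to right, that is from the lowest row up. *)
Definition cell_le (p q : nat * nat) : bool :=
  (p.1 < q.1) || ((p.1 == q.1) && (q.2 <= p.2)).

Lemma cell_le_total : total cell_le.
Proof. by move=> [a b] [c d]; rewrite /cell_le /=; lia. Qed.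

Lemma cell_le_trans : transitive cell_le.
Proof. by move=> [a b] [c d] [e f]; rewrite /cell_le /=; lia. Qed.

Lemma cell_le_anti : antisymmetric cell_le.
Proof.
move=> [a b] [c d]; rewrite /cell_le /= => le.
by have [-> ->] : a = c /\ b = d by lia.
Qed.

Definition row_of i (L : seq (nat * nat)) := [seq p.1 | p <- L & p.2 == i].

Definition rows k L := [seq row_of i L | i <- iota 0 k].

Definition cells (T : seq (seq nat)) :=
  flatten [seq [seq (v, i) | v <- nth [::] T i] | i <- iota 0 (size T)].

Lemma size_row_of i L : size (row_of i L) = count_mem i (unzip2 L).
Proof. by rewrite size_map size_filter count_map. Qed.

Lemma row_of_rcons i L v x :
  row_of i (rcons L (v, x)) =
  if x == i then rcons (row_of i L) v else row_of i L.
Proof. by rewrite /row_of filter_rcons /=; case: eqP => // _; rewrite map_rcons. Qed.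

Lemma mem_row_of i L v : v \in row_of i L -> (v, i) \in L.
Proof. by case/mapP => -[u j]; rewrite mem_filter => /andP [/= /eqP -> uL] ->. Qed.

Lemma nth_rows k L i : all (ltn^~ k) (unzip2 L) ->
  nth [::] (rows k L) i = row_of i L.
Proof.
move=> /allP Lk; case: (ltnP i k) => ik.
  by rewrite (nth_map 0) ?size_iota // nth_iota.
rewrite nth_default ?size_map ?size_iota //; apply/esym/nilP.
rewrite /nilp size_row_of; apply/eqP/count_memPn/negP => /Lk /=.
by rewrite ltnNge ik.
Qed.

(** Induction along the reading order. A cell appended to row [i.+1] needs a cell above it, which is
    the lattice condition; that cell is strictly smaller because equal entries are read from the
    lowest row up. Conversely, the last cell never lies above another one, so it can be removed. *)
Lemma lattice_columns L : all (ltn^~ 3) (unzip2 L) -> sorted cell_le L ->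
  lattice (unzip2 L) <->
  forall i j, j < size (row_of i.+1 L) ->
    (j < size (row_of i L)) && (nth 0 (row_of i L) j < nth 0 (row_of i.+1 L) j).
Proof.
elim/last_ind: L => [|L [v x] IHL]; first by split.
have LE : unzip2 (rcons L (v, x)) = rcons (unzip2 L) x by rewrite /unzip2 map_rcons.
rewrite LE all_rcons => /andP [x_lt3 L3]; have x3 : x < 3 by [].
rewrite (sorted_pairwise cell_le_trans) pairwise_rcons => /andP [/allP Lv].
rewrite -(sorted_pairwise cell_le_trans) => sL.
rewrite lattice_rcons -LE -!size_row_of.
have {}IHL := IHL L3 sL.
have le_v i u : u \in row_of i L -> cell_le (u, i) (v, x).
  by move/mem_row_of/Lv.
split=> [/and3P [/IHL colL c10 c21] i j | col].
  rewrite !row_of_rcons in c10 c21 *.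
  case: (x =P i.+1) => [xi|_] ji; last first.
    have /andP [ji' lt] := colL i j ji.
    by case: eqP => _; rewrite ?size_rcons ?nth_rcons ?ji' // ltnS (ltnW ji').
  rewrite ifF; last by lia.
  rewrite size_rcons ltnS leq_eqVlt in ji; rewrite nth_rcons.
  case/orP: ji => [/eqP ji | ji]; last by rewrite ji; exact: colL.
  rewrite ji ltnn eqxx -ji.
  (* This is the lattice inequality between the letters [i] and [i.+1], where [i] is 0 or 1. *)
  have ji' : j < size (row_of i L).
    move: c10 c21; rewrite ji xi.
    by case: i {ji} xi => [|[|i]] xi /=; rewrite ?size_rcons //; lia.
  rewrite ji' /=; have := le_v i _ (mem_nth 0 ji'); rewrite /cell_le /=; lia.
have colL i j : j < size (row_of i.+1 L) ->
    (j < size (row_of i L)) && (nth 0 (row_of i L) j < nth 0 (row_of i.+1 L) j).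
  move=> ji; have := col i j; rewrite !row_of_rcons.
  have -> : nth 0 (if x == i.+1 then rcons (row_of i.+1 L) v else row_of i.+1 L) j =
            nth 0 (row_of i.+1 L) j by case: eqP => // _; rewrite nth_rcons ji.
  have -> : j < size (if x == i.+1 then rcons (row_of i.+1 L) v else row_of i.+1 L).
    by case: eqP => // _; rewrite size_rcons ltnS ltnW.
  move=> /(_ isT); case: eqP => // _; rewrite size_rcons ltnS nth_rcons.
  rewrite leq_eqVlt => /andP [/orP [/eqP je | jl]]; last by rewrite jl.
  (* Here the last cell would lie above an entry read before it, yet be smaller. *)
  rewrite {1}je ltnn {1}je eqxx => lt.
  by have := le_v _ _ (mem_nth 0 ji); rewrite /cell_le /=; lia.
have sz i : size (row_of i.+1 (rcons L (v, x))) <= size (row_of i (rcons L (v, x))).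
  by rewrite leqNgt; apply/negP => /col; rewrite ltnn.
by apply/and3P; split; [apply/IHL | exact: sz | exact: sz].
Qed.

Lemma perm_cells_rows k L : all (ltn^~ k) (unzip2 L) -> perm_eq (cells (rows k L)) L.
Proof.
move=> Lk.
have -> : cells (rows k L) = flatten [seq [seq p <- L | p.2 == i] | i <- iota 0 k].
  rewrite /cells size_map size_iota; congr flatten; apply: eq_map => i.
  rewrite nth_rows // /row_of -map_comp -[RHS]map_id; apply/eq_in_map => -[v j].
  by rewrite mem_filter => /andP [/= /eqP ->].
have {2}<- : [seq p <- L | p.2 < k] = L.
  by apply/all_filterP; move: Lk; rewrite all_map.
move: {Lk} (L) => {}L; elim: k => [|k IHk].
  by rewrite (eq_filter (a2 := pred0)) ?filter_pred0.
rewrite -addn1 iotaD map_cat flatten_cat /= cats0 add0n addn1.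
rewrite perm_sym -(perm_filterC (fun p : nat * nat => p.2 < k)) perm_sym.
rewrite -!filter_predI (eq_filter (a1 := predI (fun p => p.2 < k) _) (a2 := fun p => p.2 < k)).
  rewrite (eq_filter (a1 := predI (predC _) _) (a2 := fun p => p.2 == k)).
    by rewrite perm_cat2r.
  by move=> p /=; lia.
by move=> p /=; lia.
Qed.

Lemma flatten_pick (S : Type) (s : seq nat) (X : nat -> seq S) i :
  uniq s -> i \in s -> flatten [seq if j == i then X j else [::] | j <- s] = X i.
Proof.
have none s' : i \notin s' -> flatten [seq if j == i then X j else [::] | j <- s'] = [::].
  elim: s' => //= j s' IHs; rewrite inE negb_or eq_sym => /andP [ji /IHs ->].
  by rewrite (negbTE ji).
elim: s => //= j s IHs /andP [js us]; rewrite inE eq_sym.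
case: eqP => [ji _ | _ /=]; last exact: IHs.
by rewrite none -?ji // cats0.
Qed.

(** Within one row the reading order is the order of the entries, so a sorted row comes back
    unchanged. *)
Lemma rows_cells T : all (sorted leq) T ->
  rows (size T) (sort cell_le (cells T)) = T.
Proof.
move=> sT; apply: (@eq_from_nth _ [::]); rewrite size_map size_iota // => i iT.
rewrite (nth_map 0) ?size_iota // nth_iota // add0n /row_of.
rewrite (filter_sort cell_le_total cell_le_trans).
have -> : [seq p <- cells T | p.2 == i] = [seq (v, i) | v <- nth [::] T i].
  rewrite filter_flatten -map_comp -[RHS](@flatten_pick _ (iota 0 (size T))
    (fun j => [seq (v, j) | v <- nth [::] T j])) ?iota_uniq ?mem_iota //.
  congr flatten; apply: eq_map => j /=; rewrite filter_map.
  case: (j =P i) => [->|/eqP/negbTE ji].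
    by rewrite (eq_filter (a2 := predT)) ?filter_predT // => u; exact: eqxx.
  by rewrite (eq_filter (a2 := pred0)) ?filter_pred0 // => u; exact: ji.
rewrite sorted_sort; last 2 first.
- exact: cell_le_trans.
- rewrite sorted_map; apply: sub_sorted (allP sT _ (mem_nth [::] iT)) => u v uv.
  by rewrite /relpre /cell_le /=; lia.
by rewrite -map_comp map_id.
Qed.

Definition compat (r w : seq nat) :=
  all (fun i => (nth 0 r i < nth 0 r i.+1) ==> (nth 0 w i < nth 0 w i.+1))
      (iota 0 (size w).-1).

(** Equal consecutive entries of [w] are in reading order exactly when the row index does not
    increase, that is, when [r] has no ascent there. *)
Lemma sorted_zip_cells (w r : seq nat) : size r = size w -> sorted leq w ->
  sorted cell_le (zip w r) = compat r w.
Proof.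
move=> srw /(sortedP 0) sw; apply/(sortedP (0, 0))/allP => H i.
  rewrite mem_iota add0n => /= iw; have := H i; rewrite size_zip srw minnn.
  by rewrite !nth_zip // /cell_le /= => /(_ _)/implyP; lia.
rewrite size_zip srw minnn !nth_zip // /cell_le /= => iw.
have := sw i iw; have /implyP := H i; rewrite mem_iota add0n /=; lia.
Qed.

Definition has_content (la r : seq nat) :=
  [&& count_mem 0 r == nth 0 la 0, count_mem 1 r == nth 0 la 1
    & count_mem 2 r == nth 0 la 2].

Lemma has_contentP la r : all (ltn^~ 3) r -> size la <= 3 ->
  reflect (forall i, count_mem i r = nth 0 la i) (has_content la r).
Proof.
move=> /allP r3 la3; apply: (iffP and3P) => [[/eqP c0 /eqP c1 /eqP c2] i | H]; last first.
  by rewrite !H.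
case: i => [|[|[|i]]] //; rewrite nth_default; last by lia.
by apply/count_memPn/negP => /r3.
Qed.

Definition row_words (la w : seq nat) :=
  [seq r <- words (size w) | [&& lattice r, has_content la r & compat r w]].

Definition tableaux_of_words (la w : seq nat) :=
  [seq rows (size la) (zip w r) | r <- row_words la w].

Lemma cells_fst T : unzip1 (cells T) = flatten T.
Proof.
rewrite /unzip1 /cells map_flatten -map_comp -[in RHS](mkseq_nth [::] T).
congr flatten.
by apply: eq_map => i /=; rewrite -map_comp map_id.
Qed.

Lemma cells_snd T : all (ltn^~ (size T)) (unzip2 (cells T)).
Proof.
apply/allP => _ /mapP [p pT ->]; case/flatten_mapP: pT => i.
by rewrite mem_iota => iT /mapP [v _ ->].
Qed.

Lemma sorted_fst L : sorted cell_le L -> sorted leq (unzip1 L).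
Proof.
by move=> sL; rewrite sorted_map; apply: sub_sorted sL => p q; rewrite /cell_le /=; lia.
Qed.

Lemma row_words_letters la w r : size la <= 3 -> r \in row_words la w ->
  all (ltn^~ (size la)) r.
Proof.
move=> la3; rewrite mem_filter mem_words => /andP [/and3P [_ cr _] /andP [_ r3]].
move/(has_contentP r3 la3): cr => cr; apply/allP => x xr /=.
rewrite ltnNge; apply/negP => /(nth_default 0); rewrite -cr => /count_memPn.
by rewrite xr.
Qed.

(** A word distributes the sorted entries [w] over the rows; a tableau gives back the row indices of
    its sorted cells. [lattice_columns] turns the lattice condition into the column condition. *)
Lemma mem_tableaux_of_words la w T : sorted leq w -> is_partition (size w) la -> size la <= 3 ->
  T \in tableaux_of_words la w <-> is_ssyt la T /\ perm_eq (flatten T) w.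
Proof.
move=> sw /and3P [sla la0 /eqP sumla] la3; split.
  case/mapP => r rw ->; have rk := row_words_letters la3 rw.
  move: rw; rewrite mem_filter mem_words => /andP [/and3P [lr cr cp] /andP [/eqP sr r3]].
  move/(has_contentP r3 la3): cr => cr.
  set L := zip w r.
  have L2 : unzip2 L = r by rewrite /L unzip2_zip ?sr.
  have L1 : unzip1 L = w by rewrite /L unzip1_zip ?sr.
  have Lk : all (ltn^~ (size la)) (unzip2 L) by rewrite L2.
  have sL : sorted cell_le L by rewrite sorted_zip_cells.
  have szrow i : size (row_of i L) = nth 0 la i by rewrite size_row_of L2 cr.
  split; last first.
    have /(perm_map fst) := perm_cells_rows Lk.
    by rewrite -/(unzip1 _) cells_fst -/(unzip1 L) L1.
  split.
  - apply: (@eq_from_nth _ 0); rewrite !size_map size_iota // => i ik.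
    by rewrite (nth_map [::]) ?size_map ?size_iota // nth_rows.
  - apply/allP => _ /mapP [i _ ->]; rewrite sorted_map.
    apply: sorted_filter; first by move=> a b c; apply: leq_trans.
    by rewrite -sorted_map; exact: sorted_fst.
  move=> i j; rewrite /entry !nth_rows // => ij.
  have L3 : all (ltn^~ 3) (unzip2 L) by rewrite L2.
  have lL : lattice (unzip2 L) by rewrite L2.
  by move/(lattice_columns L3 sL): lL => /(_ i j ij) /andP [].
case=> [[shT /allP sT colT] pT].
have skT : size T = size la by rewrite -shT size_map.
set L := sort cell_le (cells T).
have pL : perm_eq L (cells T) by rewrite perm_sort.
have sL : sorted cell_le L by apply: sort_sorted cell_le_total _.
have L1 : unzip1 L = w.
  apply: (sorted_eq leq_trans anti_leq (sorted_fst sL) sw).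
  by rewrite (perm_trans _ pT) // -cells_fst perm_map.
have Lk : all (ltn^~ (size la)) (unzip2 L).
  by rewrite (perm_all _ (perm_map snd pL)) -skT cells_snd.
have L3 : all (ltn^~ 3) (unzip2 L).
  by apply: sub_all Lk => x /= xk; exact: leq_trans la3.
have TE : rows (size la) L = T by rewrite -skT rows_cells //; apply/allP.
have Trow i : row_of i L = nth [::] T i by rewrite -(nth_rows _ Lk) TE.
have szL : size (unzip2 L) = size w by rewrite -L1 !size_map.
have zL : zip w (unzip2 L) = L by rewrite -L1 zip_unzip.
apply/mapP; exists (unzip2 L); last by rewrite zL TE.
rewrite mem_filter mem_words szL eqxx L3 !andbT /=; apply/and3P; split.
- apply/(lattice_columns L3 sL) => i j; rewrite !Trow => ij.
  (* [is_ssyt] gives strictness only; that the cell above exists follows from the shape being weakly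
     decreasing. *)
  rewrite (colT i j ij) andbT (leq_trans ij) //.
  rewrite -!nth_shape shT.
  case: (ltnP i.+1 (size la)) => ik; last by rewrite nth_default.
  have tr : transitive geq by move=> b a c /= ab bc; exact: leq_trans bc ab.
  by apply: (sorted_ltn_nth tr 0 sla); rewrite ?inE //; exact: ltnW.
- apply/(has_contentP L3 la3) => i.
  by rewrite -size_row_of Trow -shT nth_shape.
by rewrite -sorted_zip_cells ?zL.
Qed.

(** Sorting the cells of the tableau recovers [zip w r], hence the word [r]. *)
Lemma tableaux_of_words_uniq la w : sorted leq w -> size la <= 3 -> uniq (tableaux_of_words la w).
Proof.
move=> sw la3; rewrite map_inj_in_uniq ?filter_uniq ?words_uniq // => r s rw sw'.
have rk := row_words_letters la3 rw; have sk := row_words_letters la3 sw'.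
move: rw sw'; rewrite !mem_filter !mem_words.
case/andP => [/and3P [_ _ cr] /andP [/eqP sr _]].
case/andP => [/and3P [_ _ cs] /andP [/eqP ss _]] E.
have H (t : seq nat) : all (ltn^~ (size la)) t -> compat t w -> size t = size w ->
    zip w t = sort cell_le (cells (rows (size la) (zip w t))).
  move=> tk ct st; apply: (sorted_eq cell_le_trans cell_le_anti).
  - by rewrite sorted_zip_cells.
  - exact: sort_sorted cell_le_total _.
  by rewrite perm_sym perm_sort perm_cells_rows // unzip2_zip ?st.
have := H r rk cr sr; rewrite E -H // => /(congr1 (map snd)).
by rewrite -/(unzip2 _) unzip2_zip ?sr // -/(unzip2 _) unzip2_zip ?ss.
Qed.

(** * Coefficients *)

Lemma bitseqs_uniq n : uniq (bitseqs n).
Proof.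
elim: n => // n IHn; apply: allpairs_uniq => //.
by move=> _ _ /allpairsP [[b d] [_ _ ->]] /allpairsP [[c e] [_ _ ->]] [-> ->].
Qed.

Lemma sum_fibers (T : eqType) (s : seq T) (A : pred T) (f : T -> bitseq)
    (P : pred bitseq) (F : T -> nat) k :
  (forall v, v \in s -> A v -> size (f v) = k) ->
  \sum_(v <- s | A v && P (f v)) F v =
  \sum_(d <- bitseqs k | P d) \sum_(v <- s | A v && (f v == d)) F v.
Proof.
move=> sk; rewrite (exchange_big_dep (fun v => A v && P (f v))) /=; last first.
  by move=> d v Pd /andP [-> /eqP ->].
rewrite big_seq_cond [RHS]big_seq_cond; apply: eq_bigr => v /andP [vs /andP [Av Pv]].
rewrite (eq_bigl (pred1 (f v))) => [|d]; last first.
  by rewrite /= Av eq_sym /=; case: eqP => [->|]; rewrite ?Pv ?andbF.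
rewrite -big_filter filter_pred1_uniq ?bitseqs_uniq ?big_seq1 //.
by rewrite mem_bitseqs sk.
Qed.

(** The condition for a weakly increasing [w] to contribute to the fundamental series with descent
    word [d]. *)
Definition permitted (w : seq nat) (d : bitseq) :=
  all (fun i => nth false d i ==> (nth 0 w i < nth 0 w i.+1)) (iota 0 (size w).-1).

(** [size_avoiders] summed over the descent words that [w] permits. *)
Lemma sum_permitted (w : seq nat) : 0 < size w ->
  \sum_(v <- perms (size w) | avoid v && permitted w (des v)) 1 =
  \sum_(r <- words (size w) | [&& lattice r, count_mem 1 r <= 2 & permitted w (asc r)]) weight r.
Proof.
move=> w0; rewrite (@sum_fibers _ _ _ _ _ _ (size w).-1) => [|v vn _]; last first.
  by rewrite size_des (perms_size vn).
under [RHS]eq_bigl do rewrite andbA.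
rewrite [RHS](@sum_fibers _ _ (fun r => lattice r && (count_mem 1 r <= 2)) _ _ _ (size w).-1)
  => [|r]; last by rewrite mem_words size_asc => /andP [/eqP ->].
rewrite big_seq_cond [RHS]big_seq_cond; apply: eq_bigr => d.
rewrite mem_bitseqs => /andP [/eqP dw _].
have E : size w = (size d).+1 by rewrite dw prednK.
rewrite E -big_filter -[RHS]big_filter sum1_size -/(avoiders d) size_avoiders /lattice_words.
by congr (\sum_(r <- _) _); apply: eq_filter => r; rewrite andbA.
Qed.

(** * The shapes of the expansion *)

(** For small [n] some candidates are not partitions of [n], partly because subtraction is
    truncated; the filter removes them. *)
Definition shapes n := [seq la <- [:: [:: n]; [:: n - 1; 1]; [:: n - 2; 2];
  [:: n - 2; 1; 1]; [:: n - 3; 2; 1]; [:: n - 4; 2; 2]] | is_partition n la].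

Lemma shapes_uniq n : uniq (shapes n).
Proof. by apply: filter_uniq; rewrite /= !inE !eqseq_cons /= !andbF. Qed.

Lemma mem_shapes n (la : seq nat) : 0 < n ->
  (la \in shapes n) = in_H n 3 la && (size la <= 3).
Proof.
move=> n0; rewrite mem_filter /in_H; case pla: (is_partition n la) => //=.
case/and3P: pla; case: la => [|a [|b [|c [|e la]]]] /=.
- by move=> _ _ /eqP n00; rewrite -n00 in n0.
- by rewrite !inE !eqseq_cons addn0 /in_diagram /= => _ _ /eqP ->; rewrite eqxx.
- rewrite !inE !negb_or !eqseq_cons /in_diagram /=.
  by case: b => [|[|[|b]]]; rewrite ?eqxx ?andbF ?andbT /=; lia.
- rewrite !inE !negb_or !eqseq_cons /in_diagram /=.
  by case: b => [|[|[|b]]]; rewrite ?eqxx ?andbF ?andbT /=; lia.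
by rewrite andbF !inE !eqseq_cons /= !andbF.
Qed.

(** The content of [r] leaves a single possible shape, which is in the list exactly when [r] has at
    most two 1s. *)
Lemma sum_shapes (w r : seq nat) (F : seq nat -> nat) :
  0 < size w -> r \in words (size w) -> lattice r ->
  \sum_(la <- shapes (size w) | has_content la r) F la =
  if count_mem 1 r <= 2 then F [seq c <- content r | c != 0] else 0.
Proof.
move=> w0; rewrite mem_words => /andP [/eqP sr r3] /latticeP lr.
have [c10 c21] := lr (size r); rewrite take_size in c10 c21.
have csum : count_mem 0 r + count_mem 1 r + count_mem 2 r = size r.
  elim: r r3 {lr c10 c21 sr} => //= x r IHr /andP [x3 /IHr <-].
  by case: x x3 => [|[|[|x]]] //= _; lia.
set la := [seq c <- _ | _].
(* The content of a lattice word decreases weakly, so its zeros are trailing and removing them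
   exposes the default 0 of [nth]. *)
have lac i : nth 0 la i = nth 0 (content r) i.
  move: c10 c21; rewrite /la /content.
  case: (count_mem 0 r) => [|a]; case: (count_mem 1 r) => [|b];
  case: (count_mem 2 r) => [|c] h1 h2; (try by exfalso; lia);
  by case: i => [|[|[|i]]]; rewrite /= ?nth_nil.
have lap : is_partition (size w) la.
  rewrite /is_partition /la -sr -csum /content.
  case: (count_mem 0 r) c10 => [|a]; case: (count_mem 1 r) c21 => [|b];
  case: (count_mem 2 r) => [|c] //= ? ?; lia.
have lai : (la \in shapes (size w)) = (count_mem 1 r <= 2).
  rewrite mem_shapes // /in_H lap /in_diagram lac /= -leqNgt.
  by rewrite (_ : size la <= 3) ?andbT // /la size_filter count_size.
have E : {in shapes (size w), has_content^~ r =1 pred1 la}.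
  move=> x /=; rewrite mem_shapes // => /andP [/andP [/and3P [_ x0 _] _] x3].
  apply/and3P/eqP => [[/eqP E0 /eqP E1 /eqP E2] | ->]; last by rewrite !lac.
  rewrite /la /content E0 E1 E2.
  by case: x x0 x3 {E0 E1 E2} => [|[|a] [|[|b] [|[|c] [|? ?]]]].
rewrite big_seq_cond (eq_bigl (fun x => (x \in shapes (size w)) && pred1 la x)); last first.
  by move=> x; apply: andb_id2l => /E.
rewrite -big_seq_cond -lai; case: ifP => las.
  by rewrite -big_filter filter_pred1_uniq ?shapes_uniq ?big_seq1.
rewrite big_seq_cond big_pred0 // => x; rewrite andbC /=.
by case: (x =P la) => //= ->.
Qed.

Lemma seq_mset_eq (s : seq nat) (m : multiset nat) :
  (seq_mset s == m) = perm_eq s m.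
Proof.
rewrite -[m in LHS]seq_mset_id; apply/eqP/idP => [/eq_seq_msetP // | ?].
exact/eq_seq_msetP.
Qed.

(** [one_line] is injective and both lists have n! elements. *)
Lemma one_line_perms n : perm_eq [seq one_line s | s : 'S_n] (perms n).
Proof.
have olE (s : 'S_n) (i : 'I_n) : nth 0 (one_line s) i = (s i).+1.
  rewrite /one_line (@nth_map _ i _ 0 _ _ (enum 'I_n)) ?size_enum_ord //.
  by rewrite nth_ord_enum.
have ol_inj : injective (@one_line n).
  move=> s t E; apply/permP => i; apply/val_inj/succn_inj.
  by rewrite /= -!olE E.
have u1 : uniq [seq one_line s | s : 'S_n] by rewrite map_inj_uniq ?enum_uniq.
apply: uniq_perm => //; first exact: permutations_uniq.
apply: (uniq_min_size u1 _ _).2.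
  move=> _ /mapP [s _ ->]; rewrite mem_perms size_map size_enum_ord eqxx /=.
  rewrite map_inj_uniq ?enum_uniq /=; last by move=> i j [] /val_inj /perm_inj.
  by apply/allP => _ /mapP [i _ ->]; rewrite /= ltn_ord.
rewrite size_permutations ?iota_uniq // size_iota size_map -cardE.
by rewrite card_Sn.
Qed.

(** * Coefficients of the fundamental and Schur series *)

Definition sorted_mset (m : multiset nat) := sort leq m.

Lemma sorted_msetE (t : seq nat) (m : multiset nat) :
  sorted leq t -> perm_eq t m -> t = sorted_mset m.
Proof.
move=> st tm; apply: (sorted_eq leq_trans anti_leq st (sort_sorted leq_total _)).
by rewrite (perm_trans tm) // perm_sym perm_sort.
Qed.

Local Open Scope classical_set_scope.
Local Open Scope ring_scope.

(** Only the sorted word of [m] can contribute to the infinite sum, so the coefficient is 0 or 1. *)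
Lemma fundamentalE n (v : seq nat) (m : multiset nat) : size v = n ->
  fundamental (Des n v) m =
  ((size (sorted_mset m) == n) && permitted (sorted_mset m) (des v))%N%:R.
Proof.
move=> sv; set w := sorted_mset m; rewrite /fundamental /monomial.
case: eqP => [sw | ne] /=; last first.
  apply: fsbig1 => t [st _]; rewrite seq_mset_eq; case: (boolP (perm_eq _ _)) => // tm.
  by case: ne; rewrite /w -(sorted_msetE st tm) size_tuple.
pose t := tcast sw (in_tuple w).
have tw : t = w :> seq nat by rewrite val_tcast.
have E : (sorted leq t /\ (forall s : 'I_n.-1, s \in Des n v ->
    (nth 0%N t s < nth 0%N t s.+1)%N)) <-> permitted w (des v).
  rewrite tw; split=> [[_ H] | /allP H].
    apply/allP => i; rewrite mem_iota sw add0n => /= i_n; apply/implyP => di.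
    have := H (Ordinal i_n); rewrite inE /=; apply; rewrite -nth_des //; lia.
  split=> [|s]; first exact: (sort_sorted leq_total).
  rewrite inE => ds; have := H s; rewrite mem_iota sw add0n => /(_ (ltn_ord s)).
  by rewrite nth_des ?ds // sv; have := ltn_ord s; lia.
have tm : perm_eq t m by rewrite tw perm_sort.
have zero (u : n.-tuple nat) : sorted leq u -> u <> t -> (seq_mset u == m)%:R = 0 :> int.
  move=> su; rewrite seq_mset_eq; case: (boolP (perm_eq _ _)) => // um [].
  by apply: val_inj; rewrite /= tw; exact: sorted_msetE.
case: (boolP (permitted _ _)) => [/E pt | npt] /=; last first.
  apply: fsbig1 => u [su Hu]; apply: zero => // ut.
  by move/negP: npt; apply; apply/E; rewrite -ut.
rewrite -(fsbig_widen [set t]) /=.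
- by rewrite fsbig_set1 seq_mset_eq tm.
- by move=> _ ->; exact: pt.
by move=> u [[su _] ut]; apply: zero.
Qed.

(** The contributing tableaux have the entries of [m], and for [m] of size [n] they form the finite
    list [tableaux_of_words]. *)
Lemma schurE n la (m : multiset nat) : is_partition n la -> (size la <= 3)%N ->
  schur la m = ((size (sorted_mset m) == n) * size (row_words la (sorted_mset m)))%N%:R.
Proof.
move=> pla la3; set w := sorted_mset m; rewrite /schur /monomial.
case: eqP => [sw | ne]; last first.
  rewrite mul0n; apply: fsbig1 => T [shT _ _]; rewrite seq_mset_eq.
  case: (boolP (perm_eq _ _)) => // Tm; case: ne.
  rewrite size_sort -(perm_size Tm) size_flatten shT.
  by case/and3P: pla => _ _ /eqP.
have sow : sorted leq w by exact: (sort_sorted leq_total).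
rewrite -sw in pla.
have TE T := mem_tableaux_of_words T sow pla la3.
rewrite mul1n -(size_map (fun r => rows (size la) (zip w r))) -/(tableaux_of_words la w).
rewrite -(fsbig_widen [set` tableaux_of_words la w]) /=.
- rewrite -fsbig_seq ?tableaux_of_words_uniq // -sum1_size natr_sum.
  apply: eq_big_seq => T /TE [_ Tw]; rewrite seq_mset_eq.
  by rewrite (perm_trans Tw) // perm_sort.
- by move=> T /TE [].
move=> T [sT nT]; rewrite /= seq_mset_eq; case: (boolP (perm_eq _ _)) => // Tm.
by case: nT; apply/TE; split=> //; rewrite (perm_trans Tm) // perm_sym perm_sort.
Qed.

(** * Standard tableaux and the expansion of $Q_n$ *)

(** The entries 1, ..., |mu| increase strictly, so [compat] holds for every word and only the
    lattice and content conditions remain. *)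
Lemma num_sytE mu : is_partition (sumn mu) mu -> (size mu <= 3)%N ->
  num_syt mu = num_lattice_words mu.
Proof.
move=> pmu mu3; set w := iota 1 (sumn mu).
have sw : size w = sumn mu by rewrite size_iota.
have sow : sorted leq w by exact: iota_sorted.
rewrite -{1}sw in pmu.
have -> : num_lattice_words mu = size (tableaux_of_words mu w).
  rewrite size_map /row_words sw; congr size; apply: eq_filter => r.
  rewrite /has_content; congr andb; rewrite -[LHS]andbT; congr andb.
  symmetry; apply/allP => i; rewrite mem_iota sw add0n => /= i_n.
  by apply/implyP => _; rewrite !nth_iota //; lia.
rewrite /num_syt.
have -> : [set T | is_syt mu T] = [set` tableaux_of_words mu w].
  by apply/seteqP; split=> T /=; rewrite /is_syt (mem_tableaux_of_words T sow pmu mu3).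
have -> : fset_set [set` tableaux_of_words mu w] = [fset T in tableaux_of_words mu w]%fset.
  apply/fsetP => T; rewrite in_fset_set; last exact: finite_seq.
  by rewrite !inE; apply/idP/idP; rewrite inE.
by rewrite card_fseq undup_id // tableaux_of_words_uniq.
Qed.

(** Cutting the first part down to 2 keeps the parts weakly decreasing because the second part is at
    most 2. *)
Lemma bar_partition n la : in_H n 3 la -> is_partition (sumn (bar la)) (bar la).
Proof.
case: la => // a la /andP [/and3P [sla la0 _]]; rewrite /in_diagram /= => b2.
apply/and3P; split=> //=.
  by case: la sla b2 {la0} => //= b la /andP [ba ->]; lia.
by move: la0; rewrite !inE !negb_or => /andP [a0 ->]; rewrite andbT; lia.
Qed.

Lemma size_bar la : size (bar la) = size la.
Proof. by case: la. Qed.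

Lemma QE n : (0 < n)%N ->
  Q n [:: [:: 1; 2; 4; 3]; [:: 1; 3; 2; 4]; [:: 3; 1; 2; 4]; [:: 4; 3; 2; 1]]%N =
  \sum_(la <- shapes n) schur la *+ num_syt (bar la).
Proof.
move=> n0; apply/funext => m; set w := sorted_mset m.
have RE : (\sum_(la <- shapes n) schur la *+ num_syt (bar la)) m =
    (\sum_(la <- shapes n)
       (size w == n) * size (row_words la w) * num_lattice_words (bar la))%N%:R.
  rewrite fct_sumE natr_sum; apply: eq_big_seq => la.
  rewrite mem_shapes // => /andP [laH la3].
  have /andP [pla _] := laH.
  rewrite natmulfctE (schurE m pla la3) num_sytE ?size_bar //; last exact: bar_partition laH.
  by rewrite -mulrnA.
rewrite {}RE /Q fct_sumE (eq_bigl (fun s => avoid (one_line s))); last first.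
  by move=> s; exact: avoidsE.
rewrite (eq_bigr (fun s => ((size w == n) && permitted w (des (one_line s)))%N%:R)); last first.
  by move=> s _; rewrite fundamentalE // size_map size_enum_ord.
rewrite -natr_sum; congr (_%:R).
case: eqP => [sw | _] /=; last by rewrite !big1 // => *; rewrite mul0n.
rewrite -big_mkcondr.
transitivity (\sum_(v <- perms n | avoid v && permitted w (des v)) 1)%N.
  by rewrite -(perm_big _ (one_line_perms n)) big_image_cond; apply: eq_bigl.
(* Here permutations are traded for weighted lattice words. *)
have := @sum_permitted w; rewrite sw => -> //.
under [RHS]eq_bigr => la _.
  rewrite mul1n -sum1_size big_filter big_distrl /=.
  under eq_bigr do rewrite mul1n.
  over.
(* With the words outside, the inner sum over shapes has at most one term, given by [sum_shapes]. *)
rewrite (exchange_big_dep (fun r => lattice r && compat r w)) /=; last first.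
  by move=> la r _ /and3P [-> _ ->].
rewrite sw big_mkcond [RHS]big_mkcond; apply: eq_big_seq => r rn.
case: (boolP (lattice r)) => //= lr.
have cE : permitted w (asc r) = compat r w.
  rewrite /permitted /compat; apply: eq_in_all => i; rewrite mem_iota add0n => /= i_n.
  move: rn; rewrite mem_words => /andP [/eqP sr _].
  by rewrite nth_asc // sr -sw; lia.
rewrite cE; case: (compat r w); last by rewrite andbF.
under [RHS]eq_bigl do rewrite andbT.
by rewrite andbT -sw sum_shapes ?sw.
Qed.

(** The bound on [n] says $n-4\ge 2$, as the last shape requires. *)
Lemma shapes_large n : (6 <= n)%N ->
  shapes n = [:: [:: n]; [:: n - 1; 1]; [:: n - 2; 2];
    [:: n - 2; 1; 1]; [:: n - 3; 2; 1]; [:: n - 4; 2; 2]]%N.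
Proof.
move=> n6; apply/all_filterP; rewrite /= /is_partition /= !inE; lia.
Qed.

Theorem theorem4p8 :
  let Pi := [:: [:: 1; 2; 4; 3]; [:: 1; 3; 2; 4]; [:: 3; 1; 2; 4];
                [:: 4; 3; 2; 1]]%N in
  forall n : nat, (1 <= n)%N ->
    Q n Pi = \sum_(la \in [set la : seq nat | in_H n 3 la /\ (size la <= 3)%N])
               schur la *+ num_syt (bar la)
    /\ ((6 <= n)%N ->
        Q n Pi = schur [:: n]
                 + schur [:: n - 1; 1]%N *+ 2
                 + schur [:: n - 2; 2]%N *+ 2
                 + schur [:: n - 2; 1; 1]%N *+ 3
                 + schur [:: n - 3; 2; 1]%N *+ 5
                 + schur [:: n - 4; 2; 2]%N *+ 5).
Proof.
move=> Pi n n0; split=> [|n6].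
  rewrite QE // fsbig_seq ?shapes_uniq //; apply: eq_fsbigl.
  by apply/seteqP; split=> la /=; rewrite mem_shapes // => /andP.
(* For [n] at least 6 every first part is at least 2, so the coefficients are those of six fixed
   shapes, computed by counting lattice words. *)
have bE a la : (2 <= a)%N -> bar (a :: la) = (2 :: la)%N by move=> /minn_idPr /= ->.
have N0 : num_syt [:: 2]%N = 1%N by rewrite num_sytE //; vm_compute.
have N1 : num_syt [:: 2; 1]%N = 2%N by rewrite num_sytE //; vm_compute.
have N2 : num_syt [:: 2; 2]%N = 2%N by rewrite num_sytE //; vm_compute.
have N11 : num_syt [:: 2; 1; 1]%N = 3%N by rewrite num_sytE //; vm_compute.
have N21 : num_syt [:: 2; 2; 1]%N = 5%N by rewrite num_sytE //; vm_compute.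
have N22 : num_syt [:: 2; 2; 2]%N = 5%N by rewrite num_sytE //; vm_compute.
rewrite QE // shapes_large // !big_cons big_nil !bE; try lia.
by rewrite N0 N1 N2 N11 N21 N22 mulr1n addr0 !addrA.
Qed.
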